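(* Let $k$ be a field of characteristic $2$, let $s,t$ be algebraically independent over $k$, and let $\mathfrak G(x)=x^2+sx+t$. Then for every $n\ge1$, $\operatorname{Gal}(\mathfrak G^n(x)/k(s,t))\cong R_n\rtimes R_n^*$, where $R_n=\mathbb F_2[Y]/(Y^n)$ and $R_n\rtimes R_n^*$ is the group of invertible affine linear transformations $v\mapsto uv+w$ ($u\in R_n^*$, $w\in R_n$) of $R_n$.
   Context: $\mathfrak G^n$ is the $n$-fold composition; $\operatorname{Gal}(\mathfrak G^n(x)/k(s,t))$ is the Galois group of its splitting field over $k(s,t)$. *)

(* Defs.v *)
From HB Require Import structures.
From mathcomp Require Import all_boot all_order all_fingroup all_algebra all_field.
Set Implicit Arguments. Unset Strict Implicit. Unset Printing Implicit Defensive.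
Import GRing.Theory.
Local Open Scope ring_scope.

Definition kst (k : fieldType) := {fraction {poly {poly k}}}.
Definition var_s (k : fieldType) : kst k := tofrac ((('X : {poly k}))%:P).
Definition var_t (k : fieldType) : kst k := tofrac ('X : {poly {poly k}}).

Definition Gpoly (k : fieldType) : {poly kst k} :=
  'X^2 + (var_s k) *: 'X + (var_t k)%:P.
Definition Giter (k : fieldType) (n : nat) : {poly kst k} :=
  iter n (fun q => Gpoly k \Po q) 'X.

(* R_n = F_2[Y]/(Y^n), elements represented by coefficient rows of length n
   (i.e. polynomials reduced mod Y^n); multiplication is truncated product. *)
Definition Rn (n : nat) := 'rV['F_2]_n.
Definition Rn_mul (n : nat) (a b : Rn n) : Rn n := poly_rV (rVpoly a * rVpoly b).
Definition Rn_one (n : nat) : Rn n := poly_rV 1.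
Definition Rn_unit (n : nat) (u : Rn n) : bool := [exists b, Rn_mul u b == Rn_one n].

Definition AffRn (n : nat) : {set {perm Rn n}} :=
  [set sigma : {perm Rn n} | [exists u : Rn n, exists w : Rn n,
     Rn_unit u && [forall v, sigma v == Rn_mul u v + w]]].

(* Main.v *)
Require Import Defs.
From HB Require Import structures.
From mathcomp Require Import all_boot all_order all_fingroup all_algebra all_field.
From mathcomp Require Import ring zify.
Set Implicit Arguments. Unset Strict Implicit. Unset Printing Implicit Defensive.
Import Order.TTheory GRing.Theory Num.Theory.
Local Open Scope ring_scope.

(* Write phi(x) = x^2 + s x, an additive map, so that G = phi + t.  The roots of
   G^n form a coset x0 + ker phi^n, and ker phi^n is a free R_n-module of rank
   one on which Y acts as phi; Galois automorphisms therefore act on the roots by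
   invertible affine maps, and the group embeds into R_n x| R_n^*, which has
   order 2^(2n-1).  It remains to see that the splitting field has degree at
   least 2^(2n-1).  It contains two chains of solutions of
   phi(rho_(i+1)) = rho_i, one starting at rho_0 = s (generators of
   ker phi^(i+1)), the other at rho_0 = t.  Starting from the s-adic absolute
   value of k(s,t), each step of the two chains is shown to be a genuine
   quadratic extension E(rho)/E to which the absolute value extends by
   x |-> |Norm x|.  The first chain is totally ramified and the second one has
   purely inseparable residue extensions; both cases are covered by the single
   condition that 1, c, rho, c rho are orthogonal over the squares of E for
   |.|, with c = t along the first chain and c = 0 along the second. *)

(** * Absolute values and quadratic extensions *)

Section AbsoluteValues.
Variables (F : fieldType) (L : fieldExtType F) (R : realFieldType).
Implicit Types (E : {subfield L}) (nu : L -> R).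

Record absval E nu : Prop := AbsVal {
  absval_ge0 : forall x, x \in E -> 0 <= nu x;
  absval_eq0 : forall x, x \in E -> (nu x == 0) = (x == 0);
  absvalM : forall x y, x \in E -> y \in E -> nu (x * y) = nu x * nu y;
  absvalD : forall x y, x \in E -> y \in E ->
    nu (x + y) <= Num.max (nu x) (nu y) }.

Lemma absval0 E nu : absval E nu -> nu 0 = 0.
Proof. by move=> vE; apply/eqP; rewrite (absval_eq0 vE) ?rpred0. Qed.

Lemma absvalX E nu x m : absval E nu -> x \in E ->
  nu (x ^+ m.+1) = nu x ^+ m.+1.
Proof.
move=> vE xE; elim: m => [|m IH]; first by rewrite !expr1.
by rewrite exprS (absvalM vE) ?rpredX // IH -exprS.
Qed.

Lemma absval1 E nu : absval E nu -> nu 1 = 1.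
Proof.
move=> vE; have n1 : nu 1 != 0 by rewrite (absval_eq0 vE) ?rpred1 ?oner_eq0.
by apply: (mulfI n1); rewrite -(absvalM vE) ?rpred1 // !mulr1.
Qed.

Lemma absvalN E nu x : absval E nu -> x \in E -> nu (- x) = nu x.
Proof.
move=> vE xE; apply/eqP; rewrite -(@eqrXn2 _ 2)  ?(absval_ge0 vE) ?rpredN //.
by rewrite -!(absvalX 1 vE) ?rpredN // sqrrN.
Qed.

Lemma absval_sqr E nu : absval E nu -> absval E (fun x => nu x ^+ 2).
Proof.
move=> vE; split=> [x xE|x xE|x y xE yE|x y xE yE].
- exact: sqr_ge0.
- by rewrite sqrf_eq0 (absval_eq0 vE).
- by rewrite (absvalM vE) // exprMn.
- have := absvalD vE xE yE; have := absval_ge0 vE (rpredD xE yE).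
  rewrite !le_max => h /orP[] h2; apply/orP; [left|right];
  by rewrite lerXn2r // nnegrE ?(le_trans h h2).
Qed.

(** The isosceles triangle principle: x = (x + y) - y, and the term y is too small to account for
    the value of x. *)
Lemma absvalD_lt E nu x y : absval E nu -> x \in E -> y \in E ->
  nu y < nu x -> nu (x + y) = nu x.
Proof.
move=> vE xE yE yx; apply/eqP; rewrite eq_le; apply/andP; split.
  by have := absvalD vE xE yE; rewrite (max_idPl (ltW yx)).
have nyE : - y \in E by rewrite rpredN.
have := absvalD vE (rpredD xE yE) nyE.
by rewrite addrK (absvalN vE) // le_max [nu x <= nu y]leNgt yx orbF.
Qed.

(** The weighted maximum norm of a pair does not see a perturbation smaller by a factor k < 1: no
    component can exceed M, and a component attaining M keeps its value by [absvalD_lt]. *)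
Lemma absval_perturb E nu (w k M : R) x y dx dy : absval E nu -> 0 < w -> k < 1 ->
  [/\ x \in E, y \in E, dx \in E & dy \in E] ->
  M = Num.max (nu x) (w * nu y) -> nu dx <= k * M -> w * nu dy <= k * M ->
  Num.max (nu (x + dx)) (w * nu (y + dy)) = M.
Proof.
move=> vE w0 k1 [xE yE dxE dyE] eM ledx ledy.
have M0 : 0 <= M by rewrite eM le_max (absval_ge0 vE).
(* For M = 0 there is no strict inequality k M < M, but the bounds then force both perturbations to
   vanish. *)
have [M_eq0|Mn0] := eqVneq M 0.
  move: ledx ledy; rewrite M_eq0 mulr0 (pmulr_rle0 _ w0) => ldx ldy.
  have -> : dx = 0.
    by apply/eqP; rewrite -(absval_eq0 vE) // eq_le ldx (absval_ge0 vE).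
  have -> : dy = 0.
    by apply/eqP; rewrite -(absval_eq0 vE) // eq_le ldy (absval_ge0 vE).
  by rewrite !addr0 -eM.
have kM : k * M < M by rewrite gtr_pMl // lt_neqAle eq_sym Mn0.
have ldx := le_lt_trans ledx kM; have ldy := le_lt_trans ledy kM.
have ubx : nu (x + dx) <= M.
  by apply: le_trans (absvalD vE xE dxE) _; rewrite ge_max (ltW ldx) eM le_max lexx.
have uby : w * nu (y + dy) <= M.
  apply: (@le_trans _ _ (w * Num.max (nu y) (nu dy))).
    by rewrite ler_pM2l // (absvalD vE).
  by rewrite maxr_pMr ?(ltW w0) // ge_max (ltW ldy) eM le_max lexx orbT.
have [xM|] := eqVneq (nu x) M.
  rewrite (absvalD_lt vE xE dxE) ?xM //; exact/max_idPl.
have [yM _|yM xM] := eqVneq (w * nu y) M.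
  rewrite (absvalD_lt vE yE dyE) ?yM; first exact/max_idPr.
  by rewrite -(ltr_pM2l w0) yM.
by move: eM xM yM; rewrite /Num.max; case: ifP => _ ->; rewrite eqxx.
Qed.

(* 1, c, u, c u form an orthogonal family over the squares of E.  When nu s ^+ 2 <
   nu u this forces x^2 + s x + u to be irreducible over E, and the condition is
   inherited by a root of that polynomial over E(root).  For c = 0 it only
   concerns 1 and u. *)
Definition orthogonal E nu (c u : L) := forall a b d e : L,
  a \in E -> b \in E -> d \in E -> e \in E ->
  nu (a ^+ 2 + c * b ^+ 2 + u * (d ^+ 2 + c * e ^+ 2)) =
  Num.max (Num.max (nu a ^+ 2) (nu c * nu b ^+ 2))
          (nu u * Num.max (nu d ^+ 2) (nu c * nu e ^+ 2)).

(** * Extension of an absolute value along one quadratic step *)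

Section QuadraticStep.
Variables (E : {subfield L}) (nu : L -> R) (s c u r : L).
Hypotheses (char2 : 2 \in [pchar L]) (vE : absval E nu).
Hypotheses (sE : s \in E) (cE : c \in E) (uE : u \in E).
Hypotheses (su : nu s ^+ 2 < nu u) (orth : orthogonal E nu c u).
Hypothesis (root_r : r ^+ 2 + s * r + u = 0).

Let q := nu u.
Let q_gt0 : 0 < q. Proof. exact: le_lt_trans (sqr_ge0 _) su. Qed.

Let orthogonal2 a d : a \in E -> d \in E ->
  nu (a ^+ 2 + u * d ^+ 2) = Num.max (nu a ^+ 2) (nu u * nu d ^+ 2).
Proof.
move=> aE dE; have := orth aE (rpred0 E) dE (rpred0 E).
rewrite (absval0 vE) !expr0n !mulr0 !addr0 /=.
have mx (x : R) : Num.max (x ^+ 2) 0 = x ^+ 2 by apply/max_idPl/sqr_ge0.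
by rewrite !mx.
Qed.

(** The cross term is dominated. With M the right-hand side and ab nonzero, |s a b|^2 < |u| |a|^2
    |b|^2 <= M^2, since |a|^2 and |u| |b|^2 are each at most M. *)
Let quadratic_norm a b : a \in E -> b \in E ->
  nu (a ^+ 2 - s * a * b + u * b ^+ 2) = Num.max (nu a ^+ 2) (nu u * nu b ^+ 2).
Proof.
move=> aE bE; rewrite addrAC -orthogonal2 //.
have N_E : a ^+ 2 + u * b ^+ 2 \in E by rewrite rpredD ?rpredM ?rpredX.
have sabE : s * a * b \in E by rewrite !rpredM.
have [/eqP ab0|abn0] := boolP (a * b == 0); first by rewrite -mulrA ab0 mulr0 subr0.
have [an0 bn0] : a != 0 /\ b != 0 by apply/andP; rewrite -negb_or -mulf_eq0.
apply: (absvalD_lt vE) => //; rewrite ?rpredN //.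
rewrite orthogonal2 // (absvalN vE) // !(absvalM vE) ?rpredM //.
have nz x : x \in E -> x != 0 -> 0 < nu x.
  by move=> xE x0; rewrite lt_neqAle (absval_ge0 vE) // eq_sym (absval_eq0 vE) ?x0.
have [na nb] := (nz a aE an0, nz b bE bn0).
set M := Num.max _ _.
have Ma : nu a ^+ 2 <= M by rewrite le_max lexx.
have Mb : q * nu b ^+ 2 <= M by rewrite le_max lexx orbT.
have M0 : 0 <= M by apply: le_trans Ma; apply: sqr_ge0.
rewrite -(@ltr_pXn2r _ 2) // ?nnegrE ?mulr_ge0 ?(absval_ge0 vE) // !exprMn.
apply: (@lt_le_trans _ _ (q * nu a ^+ 2 * nu b ^+ 2)).
  by rewrite -!(mulrA _ (nu a ^+ 2)) ltr_pM2r // mulr_gt0 ?exprn_gt0.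
rewrite -mulrA mulrCA [M ^+ 2]expr2.
by apply: ler_pM; rewrite // ?mulr_ge0 ?sqr_ge0 // ltW.
Qed.

(** For r in E the norm form at (r, -1) would be 0, although its value is at least |u| > 0. *)
Let r_notin : r \notin E.
Proof.
apply/negP=> rE; have := quadratic_norm rE (rpredN1 E).
rewrite mulrN1 opprK sqrrN expr1n mulr1 root_r (absval0 vE) (absvalN vE) ?rpred1 //.
rewrite (absval1 vE) expr1n mulr1.
by move=> /esym/eqP; apply/negP; rewrite gt_eqF // lt_max q_gt0 orbT.
Qed.

Let deg2 : adjoin_degree E r = 2.
Proof.
apply/eqP; rewrite eqn_leq; apply/andP; split.
  have pE : 'X^2 + s *: 'X + u%:P \is a polyOver E.
    by rewrite !rpredD ?rpredX ?polyOverX ?polyOverC // polyOverZ ?polyOverX.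
  have sz : size ('X^2 + s *: 'X + u%:P) = 3.
    rewrite -addrA size_polyDl ?size_polyXn //.
    apply: leq_ltn_trans (size_polyD _ _) _; rewrite gtn_max.
    rewrite (leq_ltn_trans (size_scale_leq _ _)) ?size_polyX //=.
    by rewrite (leq_ltn_trans (size_polyC_leq1 _)).
  have : minPoly E r %| 'X^2 + s *: 'X + u%:P.
    by apply: minPoly_dvdp => //; rewrite rootE !hornerE root_r.
  move/dvdp_leq; rewrite -size_poly_gt0 sz size_minPoly => /(_ isT).
  by rewrite ltnS.
rewrite ltn_neqAle eq_sym adjoin_deg_eq1 r_notin /=.
by rewrite /adjoin_degree.
Qed.

Let E' := <<E; r>>%AS.
(* The norm of x = a + b r, read off from the coordinates a, b of x. *)
Let nu' x :=
  let p := Fadjoin_poly E r x in nu (p`_0 ^+ 2 - s * p`_0 * p`_1 + u * p`_1 ^+ 2).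

Let nu'E a b : a \in E -> b \in E ->
  nu' (a + b * r) = Num.max (nu a ^+ 2) (nu u * nu b ^+ 2).
Proof.
move=> aE bE; rewrite /nu'.
rewrite (@Fadjoin_poly_unique _ _ _ _ (a%:P + b *: 'X)).
- by rewrite !coefD !coefC !coefZ !coefX /= mulr0 mulr1 addr0 add0r quadratic_norm.
- by rewrite !rpredD ?polyOverC // polyOverZ ?polyOverX.
- apply: leq_trans (eq_leq (esym deg2)); rewrite (leq_trans (size_polyD _ _)) // geq_max.
  rewrite (leq_trans (size_polyC_leq1 _)) //=.
  by rewrite (leq_trans (size_scale_leq _ _)) ?size_polyX.
- by rewrite !hornerE.
Qed.

Let in_quadratic x : x \in E' ->
  exists a b, [/\ a \in E, b \in E & x = a + b * r].
Proof.
move=> xE; pose p := Fadjoin_poly E r x.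
have /polyOverP pE : p \is a polyOver E by apply: Fadjoin_polyOver.
exists p`_0, p`_1; split; rewrite ?pE //.
have sz : (size p <= 2)%N by apply: leq_trans (eq_leq deg2); apply: size_Fadjoin_poly.
rewrite -{1}(Fadjoin_poly_eq xE) -/p (horner_coef_wide _ sz).
by rewrite big_ord_recr big_ord1 /= expr0 expr1 mulr1.
Qed.

Let nE a b : a \in E -> b \in E ->
  nu' (a + b * r) = nu (a ^+ 2 - s * a * b + u * b ^+ 2).
Proof. by move=> aE bE; rewrite nu'E // quadratic_norm. Qed.

(** Multiplicativity is read off from the norm form ([nE]), the ultrametric inequality from the
    maximum formula ([nu'E]). *)
Let absval_quadratic : absval E' nu'.
Proof.
split.
- move=> _ /in_quadratic[a [b [aE bE ->]]].
  by rewrite nu'E // le_max sqr_ge0.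
- move=> _ /in_quadratic[a [b [aE bE ->]]]; rewrite nu'E //.
  have [-> | a0] := eqVneq a 0.
    have ge0 : 0 <= nu u * nu b ^+ 2 by rewrite mulr_ge0 ?sqr_ge0 ?(ltW q_gt0).
    rewrite add0r (absval0 vE) expr0n (max_idPr ge0).
    rewrite [LHS]mulf_eq0 (gt_eqF q_gt0) sqrf_eq0 (absval_eq0 vE) // mulf_eq0 /=.
    have [// | b0] := eqVneq b 0; apply/esym/negbTE.
    by apply: contraNneq r_notin => ->; rewrite rpred0.
  have an : 0 < nu a ^+ 2.
    by rewrite exprn_gt0 // lt_neqAle eq_sym (absval_eq0 vE) // a0 (absval_ge0 vE).
  rewrite gt_eqF ?lt_max ?an //; apply/esym/negbTE.
  have [-> | b0] := eqVneq b 0; first by rewrite mul0r addr0.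
  apply: contraNneq r_notin => /eqP; rewrite addr_eq0 => /eqP h.
  have -> : r = - a / b by rewrite h opprK mulrC mulKf.
  by rewrite rpred_div ?rpredN.
- move=> _ _ /in_quadratic[a [b [aE bE ->]]] /in_quadratic[d [e [dE eE ->]]].
  have -> : (a + b * r) * (d + e * r) =
            (a * d - u * (b * e)) + (a * e + b * d - s * (b * e)) * r.
    have : (a + b * r) * (d + e * r) - (a * d - u * (b * e)) -
      (a * e + b * d - s * (b * e)) * r = b * e * (r ^+ 2 + s * r + u) by ring.
    rewrite root_r mulr0 => h; apply/eqP.
    by rewrite -subr_eq0 opprD addrA h.
  rewrite !nE ?rpredB ?rpredD ?rpredM // -(absvalM vE).
  - by congr nu; ring.
  - by rewrite rpredD ?rpredB ?rpredM ?rpredX.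
  - by rewrite rpredD ?rpredB ?rpredM ?rpredX.
- move=> _ _ /in_quadratic[a [b [aE bE ->]]] /in_quadratic[d [e [dE eE ->]]].
  rewrite addrACA -mulrDl !nu'E ?rpredD //.
  have h x y : x \in E -> y \in E -> nu (x + y) ^+ 2 <= Num.max (nu x ^+ 2) (nu y ^+ 2).
    by move=> xE yE; apply: (absvalD (absval_sqr vE)).
  rewrite maxACA -maxr_pMr ?(ltW q_gt0) // ge_max.
  apply/andP; split; rewrite le_max; apply/orP; [left|right]; first exact: h.
  by rewrite ler_pM2l // h.
Qed.

(** The norm is taken without a square root, which [R] may lack, so values of elements of [E] get
    squared. *)
Let nu'_sqr x : x \in E -> nu' x = nu x ^+ 2.
Proof.
move=> xE; have := nu'E xE (rpred0 E); rewrite mul0r addr0 => ->.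
by rewrite (absval0 vE) expr0n mulr0 (max_idPl (sqr_ge0 _)).
Qed.

Let nu'_r : nu' r = nu u.
Proof.
have := nu'E (rpred0 E) (rpred1 E); rewrite add0r mul1r => ->.
by rewrite (absval0 vE) (absval1 vE) expr1n mulr1 expr0n (max_idPr (ltW q_gt0)).
Qed.

Let sqr_max (x y : R) : 0 <= x -> 0 <= y ->
  Num.max x y ^+ 2 = Num.max (x ^+ 2) (y ^+ 2).
Proof.
move=> x0 y0; have [xy|/ltW yx] := leP x y.
  by rewrite (max_idPr _) // lerXn2r ?nnegrE.
by rewrite (max_idPl _) // lerXn2r ?nnegrE.
Qed.

(** Expanding with r^2 = s r + u gives P + Q r plus terms divisible by s. The value of P + Q r is
    the required maximum by orthogonality over [E], and the other terms are a small perturbation in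
    the sense of [absval_perturb]. *)
Let orthogonal_quadratic : orthogonal E' nu' c r.
Proof.
move=> _ _ _ _ /in_quadratic[a1 [a2 [a1E a2E ->]]] /in_quadratic[b1 [b2 [b1E b2E ->]]]
  /in_quadratic[d1 [d2 [d1E d2E ->]]] /in_quadratic[e1 [e2 [e1E e2E ->]]].
pose A := a1 ^+ 2 + c * b1 ^+ 2; pose B := a2 ^+ 2 + c * b2 ^+ 2.
pose C := d1 ^+ 2 + c * e1 ^+ 2; pose D := d2 ^+ 2 + c * e2 ^+ 2.
have [AE BE CE DE] : [/\ A \in E, B \in E, C \in E & D \in E].
  by split; rewrite rpredD ?rpredM ?rpredX.
pose P := A + u * B; pose Q := C + u * D.
have [PE QE] : P \in E /\ Q \in E by split; rewrite rpredD ?rpredM.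
have r2 : r ^+ 2 = s * r + u.
  by rewrite -[r ^+ 2](oppr_pchar2 char2); apply: addr0_eq; rewrite addrA.
have sqD (x y : L) : (x + y) ^+ 2 = x ^+ 2 + y ^+ 2.
  by rewrite sqrrD mulr2n (addrr_pchar2 char2) addr0.
have -> : (a1 + a2 * r) ^+ 2 + c * (b1 + b2 * r) ^+ 2 +
    r * ((d1 + d2 * r) ^+ 2 + c * (e1 + e2 * r) ^+ 2) =
    (P + s * u * D) + (Q + (s * B + s ^+ 2 * D)) * r.
  rewrite !sqD !exprMn r2.
  transitivity (A + B * (s * r + u) + C * r + D * (s * r ^+ 2 + u * r)).
    by rewrite /A /B /C /D; ring.
  by rewrite r2 /P /Q; ring.
have leadE x y : x \in E -> y \in E ->
    nu (x ^+ 2 + c * y ^+ 2) = Num.max (nu x ^+ 2) (nu c * nu y ^+ 2).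
  move=> xE yE; have := orth xE yE (rpred0 E) (rpred0 E).
  rewrite expr0n mulr0 addr0 mulr0 addr0 (absval0 vE) expr0n /= mulr0 maxxx mulr0.
  by move=> ->; rewrite (max_idPl _) // le_max sqr_ge0.
(* The required maximum groups coordinates by element, whereas [orth] groups them by power of r;
   this exchanges the two groupings. *)
have regroup (x y z w C' : R) : 0 <= C' ->
    Num.max (Num.max x (q * y)) (C' * Num.max z (q * w)) =
    Num.max (Num.max x (C' * z)) (q * Num.max y (C' * w)).
  by move=> C0; rewrite !maxr_pMr ?(ltW q_gt0) // maxACA [C' * (q * w)]mulrCA.
have nc : 0 <= nu c by apply: absval_ge0 vE _ cE.
have half x1 x2 y1 y2 : x1 \in E -> x2 \in E -> y1 \in E -> y2 \in E ->
    Num.max (nu' (x1 + x2 * r) ^+ 2) (nu' c * nu' (y1 + y2 * r) ^+ 2) =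
    nu (x1 ^+ 2 + c * y1 ^+ 2 + u * (x2 ^+ 2 + c * y2 ^+ 2)) ^+ 2.
  move=> x1E x2E y1E y2E; rewrite !nu'E // nu'_sqr // -exprMn -sqr_max.
  - by rewrite regroup // -orth.
  - by rewrite le_max sqr_ge0.
  - by rewrite mulr_ge0 // le_max sqr_ge0.
rewrite !half // nu'_r nu'E ?rpredD ?rpredM ?rpredX // -/A -/B -/C -/D -/P -/Q.
have boundP : q * nu B <= nu P by rewrite /P orth // /B leadE // le_max lexx orbT.
have boundQ : q * nu D <= nu Q by rewrite /Q orth // /D leadE // le_max lexx orbT.
have boundP2 : q ^+ 2 * nu B ^+ 2 <= nu P ^+ 2.
  by rewrite -exprMn lerXn2r ?nnegrE ?mulr_ge0 ?(absval_ge0 vE) ?(ltW q_gt0).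
have boundQ2 : q ^+ 2 * nu D ^+ 2 <= nu Q ^+ 2.
  by rewrite -exprMn lerXn2r ?nnegrE ?mulr_ge0 ?(absval_ge0 vE) ?(ltW q_gt0).
set M := RHS; have eM : M = Num.max (nu P ^+ 2) (q * nu Q ^+ 2) by [].
have PM : nu P ^+ 2 <= M by rewrite eM le_max lexx.
have QM : q * nu Q ^+ 2 <= M by rewrite eM le_max lexx orbT.
(* The contraction factor is |s|^2 / |u|: each perturbing term contains s, while P and Q already
   dominate u B and u D. *)
have [k [k0 k1 kq]] : exists k, [/\ 0 <= k, k < 1 & nu s ^+ 2 = k * q].
  exists (nu s ^+ 2 / q); rewrite ltr_pdivrMr // mul1r; split=> //.
    by rewrite divr_ge0 ?sqr_ge0 ?(ltW q_gt0).
  by rewrite divfK ?gt_eqF.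
have kQM : k * (q * nu Q ^+ 2) <= k * M by apply: ler_wpM2l.
have kQM2 : k * (q * (q ^+ 2 * nu D ^+ 2)) <= k * M.
  by apply: le_trans kQM; rewrite ler_wpM2l // ler_pM2l.
apply: (@absval_perturb E (fun x => nu x ^+ 2) q k) => //.
- exact: absval_sqr.
- by split; rewrite ?rpredD ?rpredM ?rpredX.
- rewrite !(absvalM vE) ?rpredM // !exprMn kq.
  have -> : k * q * nu u ^+ 2 * nu D ^+ 2 = k * (q * (q ^+ 2 * nu D ^+ 2)).
    by rewrite /q; ring.
  exact: kQM2.
- apply: (@le_trans _ _ (q * Num.max (nu (s * B) ^+ 2) (nu (s ^+ 2 * D) ^+ 2))).
    rewrite ler_pM2l //.
    by apply: (absvalD (absval_sqr vE)); rewrite rpredM ?rpredX.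
  rewrite maxr_pMr ?(ltW q_gt0) // ge_max.
  rewrite !(absvalM vE) ?rpredX // !exprMn -!expr2 kq.
  apply/andP; split.
    have -> : q * (k * q * nu B ^+ 2) = k * (q ^+ 2 * nu B ^+ 2) by ring.
    by apply: ler_wpM2l => //; apply: le_trans PM.
  have -> : q * ((k * q) ^+ 2 * nu D ^+ 2) = k * (k * (q * (q ^+ 2 * nu D ^+ 2))).
    by ring.
  apply: le_trans kQM2; apply: ler_wpM2l => //.
  rewrite ler_piMl ?(ltW k1) // mulr_ge0 ?(ltW q_gt0) //.
  by rewrite mulr_ge0 ?sqr_ge0.
Qed.

Lemma quadratic_extension : exists nu1 : L -> R,
  [/\ \dim <<E; r>> = (2 * \dim E)%N, absval <<E; r>>%AS nu1,
      {in E, forall x, nu1 x = nu x ^+ 2}, nu1 r = nu u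
    & orthogonal <<E; r>>%AS nu1 c r].
Proof.
exists nu'; split.
- by rewrite dim_Fadjoin deg2.
- exact: absval_quadratic.
- exact: nu'_sqr.
- exact: nu'_r.
- exact: orthogonal_quadratic.
Qed.
End QuadraticStep.
End AbsoluteValues.

(** * The s-adic absolute value of k(s,t) *)

Section XAdic.
Variable A : idomainType.
Implicit Types p q : {poly A}.

(** A sigma type, not an existential, so that the exponent can enter the definition of [Xabs]. *)
Lemma factor_Xn p : p != 0 -> {mq : nat * {poly A} | mq.2.[0] != 0 & p = 'X^(mq.1) * mq.2}.
Proof.
move=> p0; have [m] := multiplicity_XsubC p 0.
rewrite subr0 => h; apply: sig2_eqW; case: h => q; rewrite p0 /= => q0 ->.
by exists (m, q); rewrite /= 1?mulrC.
Qed.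

(** The X-adic absolute value, normalised by |X| = 1/2; matching on [boolP] supplies the proof that
    [factor_Xn] takes. *)
Definition Xabs p : rat :=
  if boolP (p != 0) is AltTrue h then 2^-1 ^+ (s2val (factor_Xn h)).1 else 0.

Lemma Xabs0 : Xabs 0 = 0.
Proof. by rewrite /Xabs; case: {-}_ / boolP => // h; case/eqP: (h). Qed.

Lemma XabsE m q : q.[0] != 0 -> Xabs ('X^m * q) = 2^-1 ^+ m.
Proof.
move=> q0; have qn0 : q != 0 by apply: contraNneq q0 => ->; rewrite horner0.
rewrite /Xabs; case: {-}_ / boolP => [h|]; last first.
  by case/negP; rewrite mulf_neq0 // expf_neq0 ?polyX_eq0.
case: (factor_Xn h) => [[m' q'] /= q'0 e]; congr (_ ^+ _).
wlog lemm : m m' q q' q0 q'0 e {qn0 h} / (m <= m')%N.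
  move=> W; case/orP: (leq_total m m') => le; first exact: W e le.
  exact/esym/(W _ _ _ _ _ _ (esym e) le).
(* If m < m', cancelling 'X^m and evaluating at 0 contradicts q.[0] != 0. *)
apply/eqP; rewrite eq_sym eqn_leq lemm leqNgt; apply/negP => lt.
move: e; rewrite -(subnKC lemm) exprD -mulrA => /(mulfI (monic_neq0 (monicXn _ _))).
move=> /(congr1 (horner^~ 0)); rewrite !hornerE /= => e.
by move: q0; rewrite e expr0n subn_eq0 leqNgt lt mul0r eqxx.
Qed.

Variant Xabs_spec p : rat -> Type :=
 | Xabs_zero of p = 0 : Xabs_spec p 0
 | Xabs_nz m q of p = 'X^m * q & q.[0] != 0 : Xabs_spec p (2^-1 ^+ m).

Lemma XabsP p : Xabs_spec p (Xabs p).
Proof.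
have [->|p0] := eqVneq p 0; first by rewrite Xabs0; left.
by have [[m q] /= q0 ->] := factor_Xn p0; rewrite XabsE //; right with q.
Qed.

Lemma Xabs_ge0 p : 0 <= Xabs p.
Proof. by case: XabsP => // m *; rewrite exprn_ge0. Qed.

Lemma Xabs_eq0 p : (Xabs p == 0) = (p == 0).
Proof.
case: XabsP => [->|m q -> q0]; first by rewrite !eqxx.
have qn0 : q != 0 by apply: contraNneq q0 => ->; rewrite horner0.
by rewrite expf_eq0 /= andbF mulf_eq0 (negPf qn0) (negPf (monic_neq0 (monicXn _ _))).
Qed.

Lemma XabsM p q : Xabs (p * q) = Xabs p * Xabs q.
Proof.
case: (XabsP p) => [->|m p' -> p0]; first by rewrite !mul0r Xabs0.
case: (XabsP q) => [->|m' q' -> q0]; first by rewrite !mulr0 Xabs0.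
by rewrite mulrACA -!exprD XabsE // hornerM mulf_neq0.
Qed.

Lemma Xabs_le1 p : Xabs p <= 1.
Proof. by case: XabsP => // m *; rewrite exprn_ile1. Qed.

Lemma Xabs_unit p : p.[0] != 0 -> Xabs p = 1.
Proof. by move=> /(@XabsE 0); rewrite mul1r. Qed.

Lemma XabsX : Xabs 'X = 2^-1.
Proof. by rewrite -['X]mulr1 (@XabsE 1) // hornerC oner_eq0. Qed.

(** Taking out the smaller power of X reduces homogeneous statements about a pair to the case where
    the larger value is 1. *)
Lemma common_Xn p q : (p != 0) || (q != 0) ->
  exists m p' q', [/\ p = 'X^m * p', q = 'X^m * q' & (p'.[0] != 0) || (q'.[0] != 0)].
Proof.
wlog p0 : p q / p != 0 => [W|_].
  case/orP=> [p0|q0]; first by apply: W; rewrite // p0.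
  have [m [q' [p' [eq' ep o]]]] := W q p q0 (introT orP (or_introl q0)).
  by exists m, p', q'; split; rewrite // orbC.
have [[m p'] /= p'0 ep] := factor_Xn p0.
have [q0|/factor_Xn[[m' q'] /= q'0 eq']] := eqVneq q 0.
  by exists m, p', 0; rewrite p'0 mulr0.
have [le|/ltnW le] := leqP m m'.
  by exists m, p', ('X^(m' - m) * q'); rewrite p'0 mulrA -exprD subnKC.
by exists m', ('X^(m - m') * p'), q'; rewrite q'0 orbT mulrA -exprD subnKC.
Qed.

Lemma XabsD p q : Xabs (p + q) <= Num.max (Xabs p) (Xabs q).
Proof.
have [|/norP[]] := boolP ((p != 0) || (q != 0)); last first.
  by rewrite !negbK => /eqP-> /eqP->; rewrite addr0 Xabs0.
case/common_Xn => m [p' [q' [-> -> o]]]; rewrite -mulrDr !XabsM -maxr_pMr ?Xabs_ge0 //.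
apply: ler_wpM2l; first exact: Xabs_ge0.
apply: le_trans (Xabs_le1 _) _.
by case/orP: o => h; rewrite (Xabs_unit h) le_max lexx ?orbT.
Qed.

Lemma XabsX2 p : Xabs (p ^+ 2) = Xabs p ^+ 2.
Proof. by rewrite !expr2 XabsM. Qed.

(** After normalisation by [common_Xn] the right-hand side is 1. So is the left-hand side: the
    constant coefficient of the form is a value of an anisotropic form at a nonzero pair. *)
Lemma Xabs_norm_form (c : A) p q :
    (forall x y : A, x ^+ 2 + c * y ^+ 2 = 0 -> x = 0 /\ y = 0) ->
  Xabs (p ^+ 2 + c%:P * q ^+ 2) = Num.max (Xabs p ^+ 2) (Xabs q ^+ 2).
Proof.
move=> anis; have [|/norP[]] := boolP ((p != 0) || (q != 0)); last first.
  by rewrite !negbK => /eqP-> /eqP->; rewrite expr0n mulr0 addr0 Xabs0 maxxx.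
case/common_Xn => m [p' [q' [-> -> o]]].
have -> : Xabs ('X^m * p') = Xabs 'X^m * Xabs p' by rewrite XabsM.
have -> : Xabs ('X^m * q') = Xabs 'X^m * Xabs q' by rewrite XabsM.
have max1 : Num.max (Xabs p' ^+ 2) (Xabs q' ^+ 2) = 1.
  have le1 x : Xabs x ^+ 2 <= 1 by rewrite expr_le1 ?Xabs_le1 ?Xabs_ge0.
  by case/orP: o => /Xabs_unit->; rewrite expr1n; [apply/max_idPl|apply/max_idPr].
rewrite !exprMn (mulrCA c%:P) -mulrDr -maxr_pMr ?sqr_ge0 // max1 mulr1.
rewrite XabsM [X in _ * X]Xabs_unit ?mulr1; first by rewrite XabsX2.
rewrite hornerD horner_exp hornerM horner_exp hornerC; apply/eqP=> h.
have [p0 q0] := anis _ _ h.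
by move: o; rewrite p0 q0 eqxx.
Qed.
End XAdic.

(** * Absolute values on fraction fields *)

Section FractionAbs.
Variable D : idomainType.

Import generic_quotient.

Lemma fraction_repr (x : {fraction D}) :
  x * tofrac (\d_(repr x)) = tofrac (\n_(repr x)).
Proof.
rewrite -[x in LHS]reprK !piE; apply/eqmodP.
rewrite /= FracField.equivfE /FracField.mulf !numden_Ratio ?oner_eq0 ?mulr1 ?denom_ratioP //.
by rewrite reprK mulrC.
Qed.

Variable (f : D -> rat).
Hypotheses (f_ge0 : forall x, 0 <= f x) (f_eq0 : forall x, (f x == 0) = (x == 0)).
Hypotheses (fM : forall x y, f (x * y) = f x * f y).
Hypotheses (fD : forall x y, f (x + y) <= Num.max (f x) (f y)).

Definition fracabs (x : {fraction D}) : rat :=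
  f (\n_(repr x)) / f (\d_(repr x)).

(** Independence of the chosen representative, by cross-multiplication. *)
Lemma fracabsE x (p q : D) : q != 0 -> x * tofrac q = tofrac p -> fracabs x = f p / f q.
Proof.
move=> q0 e; have d0 := denom_ratioP (repr x); have := fraction_repr x.
move=> /(congr1 (fun y => y * tofrac q)); rewrite mulrAC e -!tofracM => /eqP.
rewrite tofrac_eq => /eqP /(congr1 f); rewrite !fM => h.
by apply/eqP; rewrite eqr_div ?f_eq0 // h.
Qed.

Lemma fracabs_tofrac p : fracabs (tofrac p) = f p.
Proof.
have f1 : f 1 = 1.
  have n1 : f 1 != 0 by rewrite f_eq0 oner_eq0.
  by apply: (mulfI n1); rewrite -fM !mulr1.
by rewrite (@fracabsE _ p 1) ?oner_eq0 ?tofrac1 ?mulr1 // f1 divr1.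
Qed.

Lemma common_denom (x y : {fraction D}) : exists p1 p2 q : D,
  [/\ q != 0, x * tofrac q = tofrac p1 & y * tofrac q = tofrac p2].
Proof.
exists (\n_(repr x) * \d_(repr y)), (\n_(repr y) * \d_(repr x)),
  (\d_(repr x) * \d_(repr y)).
rewrite mulf_neq0 ?denom_ratioP //; split=> //; rewrite !tofracM -fraction_repr.
  by rewrite mulrA.
by rewrite [X in _ * X]mulrC mulrA.
Qed.

Lemma fracabs_ge0 x : 0 <= fracabs x.
Proof. by rewrite divr_ge0. Qed.

Lemma fracabs_eq0 x : (fracabs x == 0) = (x == 0).
Proof.
have [p [_ [q [q0 e _]]]] := common_denom x x.
rewrite (fracabsE q0 e) mulf_eq0 invr_eq0 !f_eq0 (negPf q0) orbF.
by rewrite -tofrac_eq0 -e mulf_eq0 [tofrac q == 0]tofrac_eq0 (negPf q0) orbF.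
Qed.

Lemma fracabsM x y : fracabs (x * y) = fracabs x * fracabs y.
Proof.
have [p1 [p2 [q [q0 e1 e2]]]] := common_denom x y.
rewrite (fracabsE q0 e1) (fracabsE q0 e2) (@fracabsE _ (p1 * p2) (q * q)) ?mulf_neq0 //.
  by rewrite !fM mulf_div.
by rewrite !tofracM mulrACA e1 e2.
Qed.

Lemma fracabsD x y : fracabs (x + y) <= Num.max (fracabs x) (fracabs y).
Proof.
have [p1 [p2 [q [q0 e1 e2]]]] := common_denom x y.
rewrite (fracabsE q0 e1) (fracabsE q0 e2) (@fracabsE _ (p1 + p2) q) //; last first.
  by rewrite mulrDl e1 e2 tofracD.
by rewrite -maxr_pMl ?invr_ge0 // ler_wpM2r ?invr_ge0.
Qed.
End FractionAbs.

(** Parity of degrees: for nonzero x and y, x^2 has even degree and X y^2 odd degree. *)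
Lemma norm_form_X_eq0 (k : fieldType) (x y : {poly k}) :
  x ^+ 2 + 'X * y ^+ 2 = 0 -> x = 0 /\ y = 0.
Proof.
move/eqP; rewrite addr_eq0 => /eqP e.
have [y0|yn0] := eqVneq y 0.
  by move: e; rewrite y0 expr0n mulr0 oppr0 => /eqP; rewrite sqrf_eq0 => /eqP.
have xn0 : x != 0.
  apply: contraNneq yn0 => x0; move/eqP: e; rewrite x0 expr0n eq_sym oppr_eq0.
  by rewrite mulf_eq0 polyX_eq0 sqrf_eq0.
have := congr1 (fun p : {poly k} => odd (size p)) e.
rewrite size_polyN mulrC size_mulX ?expf_neq0 //.
rewrite !expr2 !size_mul //.
move: xn0 yn0; rewrite -!size_poly_gt0.
case: (size x) => // m; case: (size y) => // m' _ _.
by rewrite !addSn !addnS /= !oddD !addbb.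
Qed.

(** * Towers of quadratic extensions *)

Lemma quadratic_tower (F : fieldType) (L : fieldExtType F) (R : realFieldType)
    (E : {subfield L}) (nu : L -> R) (s c : L) (rho : nat -> L) m :
    2 \in [pchar L] -> absval E nu -> s \in E -> c \in E -> rho 0 \in E ->
    nu s <= 1 -> nu s ^+ 2 < nu (rho 0) -> orthogonal E nu c (rho 0) ->
    (forall i, (i < m)%N -> rho i.+1 ^+ 2 + s * rho i.+1 + rho i = 0) ->
  exists (E1 : {subfield L}) (nu1 : L -> R),
    [/\ (E <= E1)%VS, \dim E1 = (2 ^ m * \dim E)%N, absval E1 nu1,
        {in E, forall x, nu1 x = nu x ^+ (2 ^ m)} & orthogonal E1 nu1 c (rho m)].
Proof.
move=> char2 vE sE cE r0E s1 su orth0 rootr.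
(* The induction must also carry that [rho m] lies in the field reached and still has the value of
   [rho 0]. *)
suff [E1 [nu1 [? ? ? ? [? ? ?]]]] : exists (E1 : {subfield L}) (nu1 : L -> R),
    [/\ (E <= E1)%VS, \dim E1 = (2 ^ m * \dim E)%N, absval E1 nu1,
        {in E, forall x, nu1 x = nu x ^+ (2 ^ m)} &
        [/\ orthogonal E1 nu1 c (rho m), rho m \in E1 & nu1 (rho m) = nu (rho 0)]].
  by exists E1, nu1.
elim: m rootr => [|m IH] rootr.
  by exists E, nu; rewrite mul1n; split=> // x _; rewrite expr1.
have [|E1 [nu1 [sE1 dE1 v1 nu1E [o1 rE1 nr]]]] := IH.
  by move=> i im; apply: rootr; apply: ltnW.
have sE1' := subvP sE1.
(* The value of s is raised to the power 2^m and so does not grow, as |s| <= 1, while the value of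
   [rho m] stays fixed. *)
have s_small : nu1 s ^+ 2 < nu1 (rho m).
  rewrite nr nu1E //; apply: le_lt_trans su.
  rewrite lerXn2r ?nnegrE ?exprn_ge0 ?(absval_ge0 vE) //.
  by rewrite ler_iXnr ?expn_gt0 ?(absval_ge0 vE).
have [nu2 [d2 v2 nu2E nr2 o2]] :=
  quadratic_extension char2 v1 (sE1' _ sE) (sE1' _ cE) rE1 s_small o1 (rootr m (leqnn _)).
exists <<E1; rho m.+1>>%AS, nu2; split=> //.
- exact: subv_trans sE1 (subv_adjoin _ _).
- by rewrite d2 dE1 expnS mulnA.
- by move=> x xE; rewrite nu2E ?sE1' // nu1E // -exprM expnSr.
- by split; rewrite // ?memv_adjoin // nr2 nr.
Qed.

(** * The base field k(s,t) *)

Section BaseField.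
Variable k : fieldType.
Let D := {poly {poly k}}.
(* The inner variable of {poly {poly k}} is s, the outer one is t. *)
Let f (p : D) : rat := Xabs (swapXY p).

Let f_eq0 p : (f p == 0) = (p == 0).
Proof. by rewrite /f Xabs_eq0 swapXY_eq0. Qed.
Let fM p q : f (p * q) = f p * f q.
Proof. by rewrite /f rmorphM XabsM. Qed.
Let fD p q : f (p + q) <= Num.max (f p) (f q).
Proof. by rewrite /f rmorphD XabsD. Qed.
Let f_ge0 p : 0 <= f p. Proof. exact: Xabs_ge0. Qed.

Definition sabs : kst k -> rat := fracabs f.

Lemma sabs_s : sabs (var_s k) = 2^-1.
Proof. by rewrite /sabs fracabs_tofrac // /f swapXY_Y XabsX. Qed.

Lemma sabs_t : sabs (var_t k) = 1.
Proof.
rewrite /sabs fracabs_tofrac // /f swapXY_X Xabs_unit //.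
by rewrite hornerC polyX_eq0.
Qed.

(** With denominators cleared, this is [Xabs_norm_form] for the form x^2 + t y^2 over k[t],
    anisotropic by [norm_form_X_eq0]. *)
Lemma sabs_norm_form a b :
  sabs (a ^+ 2 + var_t k * b ^+ 2) = Num.max (sabs a ^+ 2) (sabs b ^+ 2).
Proof.
have [p1 [p2 [q [q0 e1 e2]]]] := common_denom a b.
rewrite /sabs (fracabsE f_eq0 fM q0 e1) (fracabsE f_eq0 fM q0 e2).
rewrite (@fracabsE _ f f_eq0 fM _ (p1 ^+ 2 + 'X * p2 ^+ 2) (q ^+ 2)) ?expf_neq0 //; last first.
  rewrite tofracD !tofracXn tofracM tofracXn -e1 -e2 -/(var_t k).
  by ring.
rewrite /f rmorphD !rmorphXn /= rmorphM rmorphXn /= swapXY_X.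
rewrite Xabs_norm_form; last exact: norm_form_X_eq0.
by rewrite XabsX2 !expr_div_n maxr_pMl // invr_ge0 sqr_ge0.
Qed.

Lemma sabs_dyadic a : a != 0 -> exists z : int, sabs a = 2 ^ z.
Proof.
have [p [_ [q [q0 e _]]]] := common_denom a a; move=> a0.
have : sabs a != 0 by rewrite /sabs fracabs_eq0.
rewrite /sabs (fracabsE f_eq0 fM q0 e) /f.
case: XabsP => [_|m p' _ _]; first by rewrite mul0r eqxx.
case: XabsP => [_|m' q' _ _]; first by rewrite invr0 mulr0 eqxx.
move=> _; exists (m'%:Z - m%:Z); rewrite expfzDr // -exprnN -exprnP !exprVn invrK.
by rewrite mulrC.
Qed.

Variable L : fieldExtType (kst k).
Let s : L := (var_s k)%:A.
Let t : L := (var_t k)%:A.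

(** 1 and t are orthogonal over squares because t is not a square in the residue field k(t); s
    separates the two halves because |s| is an odd power of 2. *)
Lemma base_absval : exists nu : L -> rat,
  [/\ absval 1%AS nu, nu s = 2^-1, nu t = 1 & orthogonal 1%AS nu t s].
Proof.
(* [coord] recovers the scalar from an element of the line of 1; off that line the value is
   arbitrary. *)
pose nu (x : L) := sabs (coord [tuple (1 : L)] ord0 x).
have nuE a : nu a%:A = sabs a.
  have /coord_free h : free [tuple (1 : L)] by rewrite seq1_free oner_eq0.
  by rewrite /nu linearZ /= (h ord0 ord0) mulr1.
have one (x : L) : x \in 1%AS -> exists a, x = a%:A by move/vlineP.
have algM a b : a%:A * b%:A = (a * b)%:A :> L := esym (rmorphM (in_alg L) a b).
have algD a b : a%:A + b%:A = (a + b)%:A :> L := esym (rmorphD (in_alg L) a b).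
have algX a m : a%:A ^+ m = (a ^+ m)%:A :> L := esym (rmorphXn (in_alg L) m a).
have vE : absval 1%AS nu.
  split=> [x /one[a ->]|x /one[a ->]|x y /one[a ->] /one[b ->]|x y /one[a ->] /one[b ->]].
  - by rewrite nuE /sabs fracabs_ge0.
  - by rewrite nuE /sabs fracabs_eq0 // scaler_eq0 oner_eq0 orbF.
  - by rewrite algM !nuE /sabs fracabsM.
  - by rewrite algD !nuE /sabs fracabsD.
exists nu; split; rewrite ?nuE ?sabs_s ?sabs_t //.
have inE (a : kst k) : a%:A \in (1%AS : {subfield L}) by apply/vlineP; exists a.
move=> _ _ _ _ /one[a ->] /one[b ->] /one[d ->] /one[e ->].
rewrite !nuE sabs_s sabs_t !mul1r.
have lead x y : nu (x%:A ^+ 2 + t * y%:A ^+ 2) = Num.max (sabs x ^+ 2) (sabs y ^+ 2).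
  by rewrite !algX algM algD nuE sabs_norm_form.
have dyadic x y : Num.max (sabs x ^+ 2) (sabs y ^+ 2) != 0 ->
    exists z : int, Num.max (sabs x ^+ 2) (sabs y ^+ 2) = 2 ^ (z * 2).
  have sq w : sabs w ^+ 2 != 0 -> exists z : int, sabs w ^+ 2 = 2 ^ (z * 2).
    have sabs_eq0 : (sabs w == 0) = (w == 0) by rewrite /sabs fracabs_eq0.
    rewrite sqrf_eq0 sabs_eq0 => /sabs_dyadic[z ->].
    by exists z; rewrite exprnP exprz_exp.
  by rewrite /Num.max; case: ifP => _ /sq.
have sE : s \in 1%AS := inE _; have tE : t \in 1%AS := inE _.
set P := _ + t * _; set Q := _ + t * _.
have PE : P \in 1%AS by rewrite rpredD ?rpredM ?rpredX ?inE.
have QE : Q \in 1%AS by rewrite rpredD ?rpredM ?rpredX ?inE.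
(* nu P is an even power of 2 and nu (s * Q) an odd one. *)
have nsQ : nu (s * Q) = 2^-1 * nu Q by rewrite (absvalM vE) // nuE sabs_s.
have sQE : s * Q \in 1%AS by rewrite rpredM.
rewrite -(lead a b) -(lead d e) -/P -/Q -nsQ.
have [lt|lt|e0] := ltgtP (nu P) (nu (s * Q)).
- by rewrite addrC (absvalD_lt vE).
- by rewrite (absvalD_lt vE).
have [Q0|Qn0] := eqVneq (nu Q) 0.
  have /eqP : nu (s * Q) = 0 by rewrite nsQ Q0 mulr0.
  by rewrite (absval_eq0 vE) // => /eqP->; rewrite addr0.
have Pn0 : nu P != 0 by rewrite e0 nsQ mulf_neq0.
case: (dyadic a b); rewrite -lead // => z ez.
case: (dyadic d e); rewrite -lead // => w ew.
have : (2 : rat) ^ (z * 2 + 1) = 2 ^ (w * 2).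
  by rewrite expfzDr // -ez -ew -/P -/Q e0 nsQ expr1z mulrAC mulVf ?mul1r.
move/(@ieexprIz rat 2 isT isT) => h; exfalso; lia.
Qed.
End BaseField.

(** The tower over s is climbed first, with c = t, so that 1 and t remain orthogonal over the
    squares of its top field; this starts the tower over t, with c = 0. *)
Lemma dim_two_towers (k : fieldType) (L : fieldExtType (kst k)) n (lam w : nat -> L) :
    2 \in [pchar L] ->
    let s := (var_s k)%:A in let t := (var_t k)%:A in
    lam 0 = s -> w 0 = t ->
    (forall i, (i < n)%N -> lam i.+1 ^+ 2 + s * lam i.+1 + lam i = 0) ->
    (forall i, (i < n.+1)%N -> w i.+1 ^+ 2 + s * w i.+1 + w i = 0) ->
  (2 ^ n.+1 * 2 ^ n <= \dim {:L})%N.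
Proof.
move=> char2 s t lam0 w0 lamS wS.
have [nu [v0 nus nut orth0]] := base_absval L.
have [sE tE] : s \in 1%AS /\ t \in 1%AS by split; apply/vlineP; eexists.
have [|||||E1 [nu1 [_ d1 v1 nu1E o1]]] :=
  @quadratic_tower _ L _ 1%AS nu s t lam n char2 v0 sE tE; rewrite ?lam0 ?nus //.
have in1 : {subset 1%AS <= E1} by apply/subvP/sub1v.
have nu1t : nu1 t = 1 by rewrite nu1E // nut expr1n.
have nu1s : nu1 s < 1 by rewrite nu1E // nus exprn_ilt1 // expn_eq0.
have nu1s2 : nu1 s ^+ 2 < 1.
  by rewrite exprn_ilt1 // (absval_ge0 v1) ?in1.
have [|||||E2 [nu2 [_ d2 _ _ _]]] :=
  @quadratic_tower _ L _ E1 nu1 s 0 w n.+1 char2 v1 (in1 _ sE) (rpred0 _);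
  rewrite ?w0 ?nu1t ?(ltW nu1s) //.
- exact: in1.
(* For c = 0 the condition only involves a^2 + t d^2, which is the inherited orthogonality with its
   last two arguments 0. *)
- move=> a b d e aE bE dE eE; have := o1 a d 0 0 aE dE (rpred0 _) (rpred0 _).
  rewrite !mul0r !addr0 expr0n mulr0 addr0 mulr0 addr0 nu1t mul1r => ->.
  rewrite (absval0 v1) !mul1r maxxx expr0n mulr0 !mul0r.
  have mx (x : rat) : Num.max (x ^+ 2) 0 = x ^+ 2 by apply/max_idPl/sqr_ge0.
  by rewrite !mx (max_idPl _) // le_max sqr_ge0.
move: d2; rewrite d1 dimv1 muln1 => <-; exact/dimvS/subvf.
Qed.

(** * Galois automorphisms as affine maps *)

Lemma F2P (a : 'F_2) : a = 0 \/ a = 1.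
Proof. by case: a => [[|[|//]] h]; [left|right]; apply: val_inj. Qed.

Lemma pchar_kst (k : fieldType) : 2 \in [pchar k] -> 2 \in [pchar kst k].
Proof.
move=> char2; apply: (rmorph_pchar (@tofrac {poly {poly k}})).
by apply: (rmorph_pchar (@polyC {poly k})); apply: (rmorph_pchar (@polyC k)).
Qed.

(** * Iterates of x^2 + s x + t: degree, derivative, evaluation *)

Section IteratePolynomial.
Variables (F : fieldType) (char2 : 2 \in [pchar F]) (s t : F).
Let G : {poly F} := 'X^2 + s *: 'X + t%:P.

(** [Giter] over an arbitrary base field; the two agree by conversion at [var_s] and [var_t]. *)
Definition iter_poly m : {poly F} := iter m (fun q => G \Po q) 'X.

Let size_G : size G = 3.
Proof.
rewrite /G -addrA size_polyDl ?size_polyXn //.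
rewrite (leq_ltn_trans (size_polyD _ _)) // gtn_max.
rewrite (leq_ltn_trans (size_scale_leq _ _)) ?size_polyX //=.
by rewrite (leq_ltn_trans (size_polyC_leq1 _)).
Qed.

Lemma size_iter_poly m : size (iter_poly m) = (2 ^ m).+1.
Proof.
elim: m => [|m IH]; first by rewrite size_polyX.
have := size_comp_poly G (iter_poly m); rewrite IH size_G /= -expnS => e.
rewrite -e prednK // lt0n; apply/negP=> /eqP s0.
by have := expn_gt0 2 m.+1; rewrite -e s0.
Qed.

(** In characteristic 2 the derivative of [G] is the constant s, so the chain rule yields a power of
    s; for s nonzero this gives separability. *)
Lemma deriv_iter_poly m : (iter_poly m)^`() = (s ^+ m)%:P.
Proof.
elim: m => [|m IH]; first by rewrite derivX expr0.
rewrite /iter_poly iterS deriv_comp -/(iter_poly m) IH.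
have -> : G^`() = s%:P.
  have two0 : 2%:R = 0 :> F by apply: pcharf0.
  rewrite /G !derivE -scaler_nat two0.
  by rewrite scale0r add0r addr0 alg_polyC.
by rewrite comp_polyC -polyCM exprS.
Qed.

Lemma horner_map_iter_poly (L : fieldExtType F) m (x : L) :
  (map_poly (in_alg L) (iter_poly m)).[x] =
  iter m (fun y => y ^+ 2 + s%:A * y + t%:A) x.
Proof.
elim: m x => [|m IH] x; first by rewrite map_polyX hornerX.
rewrite /iter_poly iterS map_comp_poly horner_comp -/(iter_poly m) IH /=.
rewrite /G !rmorphD /= map_polyXn map_polyZ map_polyX map_polyC /=.
by rewrite !hornerE.
Qed.
End IteratePolynomial.

(** * An upper bound for the order of the affine group of R_n *)

Section Affine.
Variables (m : nat).
Local Notation n := m.+1.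

Lemma Rn_mul1 (u : Rn n) : Rn_mul u (Rn_one n) = u.
Proof. by rewrite /Rn_mul poly_rV_K ?size_poly1 // mulr1 rVpolyK. Qed.

Lemma Rn_mul0 (u : Rn n) : Rn_mul u 0 = 0.
Proof. by rewrite /Rn_mul !linear0 mulr0 linear0. Qed.

Lemma Rn_unit_coef0 (u : Rn n) : Rn_unit u -> u 0 0 != 0.
Proof.
case/existsP=> b /eqP/rowP/(_ 0%R); rewrite !mxE coef1 coef0M.
by rewrite (coef_rVpoly_ord u 0%R); apply: contra_eq_neq => ->; rewrite mul0r eq_sym oner_eq0.
Qed.

(** Adding 1 flips the constant coefficient, hence maps the set injectively into its complement. *)
Lemma card_coef0_neq0 : (2 * #|[set u : Rn n | u 0%R 0%R != 0%R]| <= 2 ^ n)%N.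
Proof.
set U := [set u | _].
have -> : (2 ^ n)%N = #|Rn n| by rewrite card_mx card_Fp ?mul1n.
rewrite -(cardsC U) mul2n -addnn leq_add2l.
have tinj : injective (fun u : Rn n => u + Rn_one n) by apply: addIr.
rewrite -(card_imset U tinj); apply/subset_leq_card/subsetP=> _ /imsetP[u uU ->].
move: uU; rewrite !inE !mxE coef1 /= negbK.
by case: (F2P (u 0 0)) => ->; rewrite ?eqxx.
Qed.

(** An affine map is determined by its values at 0 and 1, and its linear coefficient, being a unit,
    has nonzero constant coefficient. *)
Lemma card_AffRn : (#|AffRn n| <= 2 ^ n * 2 ^ m)%N.
Proof.
pose coords (sigma : {perm Rn n}) := (sigma 0, sigma (Rn_one n) - sigma 0).
have affE sigma : sigma \in AffRn n -> exists u w,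
    [/\ Rn_unit u, sigma =1 (fun v => Rn_mul u v + w) & coords sigma = (w, u)].
  rewrite inE => /existsP[u /existsP[w /andP[uu /forallP sE]]]; exists u, w.
  have sE' v : sigma v = Rn_mul u v + w by apply/eqP/sE.
  by split=> //; rewrite /coords !sE' Rn_mul0 Rn_mul1 add0r addrK.
have inj_coords : {in AffRn n &, injective coords}.
  move=> s1 s2 /affE[u1 [w1 [_ E1 ->]]] /affE[u2 [w2 [_ E2 ->]]] [ew eu].
  by apply/permP=> v; rewrite E1 E2 ew eu.
rewrite -(card_in_imset inj_coords).
apply: (@leq_trans #|setX [set: Rn n] [set u : Rn n | u 0 0 != 0]|).
  apply/subset_leq_card/subsetP=> _ /imsetP[sigma /affE[u [w [uu _ ->]]] ->].
  by rewrite !inE /= Rn_unit_coef0.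
rewrite cardsX cardsT card_mx card_Fp // mul1n leq_pmul2l ?expn_gt0 //.
by rewrite -(@leq_pmul2l 2) // -expnS card_coef0_neq0.
Qed.
End Affine.

(** * The roots as a coset of ker phi^n, and the Galois action on them *)

Section AffineGalois.
Variables (F : fieldType) (char2 : 2 \in [pchar F]) (s t : F) (s_neq0 : s != 0).
Variables (L : splittingFieldType F) (m : nat).
Local Notation n := m.+1.
Local Notation P := (map_poly (in_alg L) (iter_poly s t n)).
Hypothesis splitP : splittingFieldFor 1%VS P {:L}.

Let S : L := s%:A.
Let T : L := t%:A.
Let Phi (x : L) := x ^+ 2 + S * x.
Let g (x : L) := x ^+ 2 + S * x + T.

Let char2L : 2 \in [pchar L]. Proof. by rewrite pchar_lalg. Qed.

Let S_neq0 : S != 0. Proof. by rewrite scaler_eq0 oner_eq0 orbF. Qed.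

Let sqrD2 (x y : L) : (x + y) ^+ 2 = x ^+ 2 + y ^+ 2.
Proof. by rewrite sqrrD mulr2n (addrr_pchar2 char2L) addr0. Qed.

Let PhiD : {morph Phi : x y / x + y}.
Proof. by move=> x y; rewrite /Phi sqrD2 mulrDr addrACA. Qed.

Let gE x : g x = Phi x + T. Proof. by []. Qed.

Let Phi0 : Phi 0 = 0. Proof. by rewrite /Phi expr0n mulr0 addr0. Qed.

Let iterPhi0 i : iter i Phi 0 = 0.
Proof. by elim: i => // i IH; rewrite iterS IH. Qed.

Let gD i x y : iter i g (x + y) = iter i g x + iter i Phi y.
Proof. by elim: i => // i IH; rewrite !iterS IH !gE PhiD addrAC. Qed.

Let root_iter i x : (map_poly (in_alg L) (iter_poly s t i)).[x] = iter i g x.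
Proof. exact: horner_map_iter_poly. Qed.

Let size_map_iter i : size (map_poly (in_alg L) (iter_poly s t i)) = (2 ^ i).+1.
Proof. by rewrite size_map_poly size_iter_poly. Qed.

Let sep_P : separable_poly P.
Proof.
rewrite separable_map unlock deriv_iter_poly // -alg_polyC.
by rewrite coprimepZr ?coprimep1 // expf_neq0.
Qed.

Lemma affine_iter_roots : exists rs : seq L,
  [/\ uniq rs, size rs = (2 ^ n)%N, (forall x, (x \in rs) = (iter n g x == 0))
    & <<1 & rs>>%VS = {:L}%VS].
Proof.
have [rs eqP defL] := splitP; exists rs; split=> //.
- by rewrite -separable_prod_XsubC -(eqp_separable eqP).
- by have /eqp_size := eqP; rewrite size_prod_XsubC size_map_iter => -[].
- by move=> x; rewrite -root_prod_XsubC -(eqp_root eqP) rootE root_iter.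
Qed.

(** At most 2^m of the 2^n roots x satisfy g^m(x) = g^m(x0), so some difference lam = x - x0 has y =
    phi^m(lam) nonzero; then y (y + S) = phi(y) = 0 gives y = S. *)
Lemma kernel_generator x0 : iter n g x0 = 0 ->
  exists2 lam, iter n Phi lam = 0 & iter m Phi lam = S.
Proof.
move=> gx0; have [rs [uniq_rs size_rs rsE _]] := affine_iter_roots.
pose q := map_poly (in_alg L) (iter_poly s t m) - (iter m g x0)%:P.
have size_q : size q = (2 ^ m).+1.
  rewrite size_polyDl size_map_iter // size_polyN.
  by rewrite (leq_ltn_trans (size_polyC_leq1 _)) // ltnS expn_gt0.
have [x xrs qx] : exists2 x, x \in rs & ~~ root q x.
  apply/hasP; rewrite has_predC; apply/negP=> all_roots.
  have qn0 : q != 0 by rewrite -size_poly_eq0 size_q.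
  have := max_poly_roots qn0 all_roots uniq_rs.
  by rewrite size_q size_rs ltnS leq_exp2l // ltnn.
pose lam := x - x0; have ex : x = x0 + lam by rewrite addrC subrK.
have lam0 : iter n Phi lam = 0.
  by move: xrs; rewrite rsE ex gD gx0 add0r => /eqP.
exists lam => //; have lamm : iter m Phi lam != 0.
  move: qx; rewrite rootE /q hornerD hornerN hornerC root_iter ex gD.
  by rewrite addrAC subrr add0r.
have : iter m Phi lam * (iter m Phi lam + S) = 0.
  by rewrite -lam0 iterS /Phi mulrDr -expr2 [_ * S]mulrC.
move/eqP; rewrite mulf_eq0 (negPf lamm) addr_eq0 => /eqP->.
by rewrite (oppr_pchar2 char2L).
Qed.

Section Parametrization.
Variables (x0 lam : L).
Hypotheses (gx0 : iter n g x0 = 0) (lam_n : iter n Phi lam = 0).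
Hypothesis lam_m : iter m Phi lam = S.

(** The chain is indexed backwards, from phi^m(lam) = S at i = 0 to lam at i = m. *)
Lemma tower_lam i : (i < m)%N ->
  iter (m - i.+1) Phi lam ^+ 2 + S * iter (m - i.+1) Phi lam + iter (m - i) Phi lam = 0.
Proof.
move=> im; rewrite -/(Phi _) -iterS -subSn // subSS.
by rewrite (addrr_pchar2 char2L).
Qed.

Let w i := iter (n - i) Phi (x0 + g x0).

(* phi^n (x0 + g x0) = g^n (2 x0 + g x0) = g (g^n x0) = g 0 = t. *)
Lemma tower_w0 : w 0 = T.
Proof.
have : iter n g (x0 + (x0 + g x0)) = w 0.
  by rewrite gD gx0 add0r.
by rewrite addrA (addrr_pchar2 char2L) add0r -iterSr iterS gx0 gE Phi0 add0r => <-.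
Qed.

Lemma tower_w i : (i < n)%N -> w i.+1 ^+ 2 + S * w i.+1 + w i = 0.
Proof.
move=> im; rewrite -/(Phi _) -iterS -subSn // subSS.
by rewrite (addrr_pchar2 char2L).
Qed.

(** The embedding of the prime field; its values equal their own squares, which makes [Phi] linear
    over it. *)
Let c (a : 'F_2) : L := (a != 0)%:R.

Let cD a b : c (a + b) = c a + c b.
Proof.
case: (F2P a) => ->; case: (F2P b) => ->;
  rewrite /c ?addr0 ?add0r ?eqxx ?oner_eq0 ?addr0 ?add0r //=.
by rewrite (addrr_pchar2 char2L).
Qed.

Let c_sqr a : c a ^+ 2 = c a.
Proof. by rewrite /c; case: eqP; rewrite ?expr0n ?expr1n. Qed.

(* e p = p(phi)(lam); the terms of degree at least n vanish. *)
Let e (p : {poly 'F_2}) : L := \sum_(i < n) c p`_i * iter i Phi lam.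

Let eD p q : e (p + q) = e p + e q.
Proof. by rewrite /e -big_split; apply: eq_bigr => i _; rewrite coefD cD mulrDl. Qed.

Let eC a : e a%:P = c a * lam.
Proof.
rewrite /e big_ord_recl coefC /= big1 ?addr0 // => i _.
by rewrite coefC /= /c eqxx mul0r.
Qed.

Let PhiZ a x : Phi (c a * x) = c a * Phi x.
Proof. by rewrite /Phi exprMn c_sqr mulrDr (mulrCA S). Qed.

(** Multiplication by Y becomes [Phi]; truncation does no harm because phi^n(lam) = 0. *)
Let eMX p : e (p * 'X) = Phi (e p).
Proof.
rewrite /e big_ord_recl coefMX /= {1}/c eqxx mul0r add0r.
rewrite (big_morph Phi PhiD Phi0) big_ord_recr /= PhiZ -iterS lam_n mulr0 addr0.
by apply: eq_bigr => i _; rewrite coefMX /= PhiZ.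
Qed.

Let eMXn p i : e (p * 'X^i) = iter i Phi (e p).
Proof. by elim: i => [|i IH]; rewrite ?mulr1 // exprSr mulrA eMX IH. Qed.

Let e_top p : iter m Phi (e p) = c p`_0 * S.
Proof.
rewrite -eMXn /e big_ord_recr /= coefMXn ltnn subnn lam_m big1 ?add0r // => i _.
by rewrite coefMXn ltn_ord /c eqxx mul0r.
Qed.

Let e_ker p : iter n Phi (e p) = 0.
Proof. by rewrite iterS e_top PhiZ -lam_m -iterS lam_n mulr0. Qed.

Let eB p q : e (p - q) = e p - e q.
Proof. by have := eD (p - q) q; rewrite subrK => ->; rewrite addrK. Qed.

(** A nonzero p is X^i q with q(0) nonzero and i <= m; applying phi^(m-i) to e(p) leaves q(0) S,
    which is nonzero. *)
Let e_eq0 (p : {poly 'F_2}) : (size p <= n)%N -> e p = 0 -> p = 0.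
Proof.
move=> szp ep; apply/eqP; apply/negPn/negP => /factor_Xn[[i q] /= q0 ep'].
have qn0 : q != 0 by apply: contraNneq q0 => ->; rewrite horner0.
have im : (i <= m)%N.
  move: szp; rewrite ep' mulrC size_mulXn // => h.
  by rewrite -ltnS; apply: leq_trans h; rewrite -addn1 leq_add2l size_poly_gt0.
have : iter (m - i) Phi (e p) = 0 by rewrite ep iterPhi0.
rewrite -eMXn ep' mulrAC -exprD subnKC //.
rewrite mulrC eMXn e_top => /eqP; rewrite mulf_eq0 (negPf S_neq0) orbF.
by rewrite -horner_coef0 /c q0 oner_eq0.
Qed.

Let h (v : Rn n) := x0 + e (rVpoly v).

Let e_poly_rV p : e (rVpoly (poly_rV p : Rn n)) = e p.
Proof. by apply: eq_bigr => i _; rewrite coef_rVpoly_ord mxE. Qed.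

Let h_inj : injective h.
Proof.
move=> u v /addrI euv; apply/eqP; rewrite -subr_eq0; apply/eqP/(can_inj rVpolyK).
rewrite linear0; apply: e_eq0; first exact: size_poly.
by rewrite linearB /= eB euv subrr.
Qed.

Let h_root v : iter n g (h v) = 0.
Proof. by rewrite gD gx0 add0r e_ker. Qed.

(** By counting: [h] is injective from the 2^n elements of R_n into the 2^n roots. *)
Let root_h x : iter n g x = 0 -> exists v, x = h v.
Proof.
have [rs [uniq_rs size_rs rsE _]] := affine_iter_roots => gx.
have sub : {subset codom h <= rs}.
  by move=> _ /codomP[v ->]; rewrite rsE h_root.
have uniq_h : uniq (codom h) by rewrite map_inj_uniq ?enum_uniq.
have le_size : (size rs <= size (codom h))%N.
  by rewrite size_rs size_codom card_mx card_Fp // mul1n.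
have [_ eq_rs] := uniq_min_size uniq_h sub le_size.
have : x \in rs by rewrite rsE gx.
by rewrite -eq_rs => /codomP[v ->]; exists v.
Qed.

Section GaloisAction.
Variable sigma : gal_of {:L}.

Let sigma_S : sigma S = S. Proof. exact: rmorph_alg. Qed.
Let sigma_T : sigma T = T. Proof. exact: rmorph_alg. Qed.

Let sigma_Phi1 x : sigma (Phi x) = Phi (sigma x).
Proof. by rewrite /Phi rmorphD rmorphXn rmorphM /= sigma_S. Qed.

Let sigma_Phi i x : sigma (iter i Phi x) = iter i Phi (sigma x).
Proof. by elim: i => // i IH; rewrite !iterS -IH sigma_Phi1. Qed.

Lemma gal_iter_g i x : sigma (iter i g x) = iter i g (sigma x).
Proof.
by elim: i => // i IH; rewrite !iterS -IH !gE rmorphD /= sigma_T sigma_Phi1.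
Qed.

Let sigma_c a : sigma (c a) = c a.
Proof. by rewrite /c rmorph_nat. Qed.

Lemma gal_root v : exists v', sigma (h v) = h v'.
Proof. by apply: root_h; rewrite -gal_iter_g h_root rmorph0. Qed.

Lemma gal_lam : exists u : Rn n, sigma lam = e (rVpoly u).
Proof.
have [|u hu] := @root_h (x0 + sigma lam); last by exists u; apply: addrI hu.
by rewrite gD gx0 -sigma_Phi lam_n rmorph0 addr0.
Qed.

(** [sigma] commutes with [Phi] and fixes the prime field, so it is R_n-linear on the kernel and
    determined by the image of lam. *)
Lemma gal_linear (u : Rn n) p : sigma lam = e (rVpoly u) -> sigma (e p) = e (rVpoly u * p).
Proof.
move=> su; elim/poly_ind: p => [|p a IH].
  by rewrite mulr0 -[0]subr0 eB subrr rmorph0.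
rewrite eD rmorphD /= eMX sigma_Phi1 IH eC rmorphM /= sigma_c su.
rewrite mulrDr eD mulrA eMX; congr (_ + _).
case: (F2P a) => ->.
  by rewrite polyC0 mulr0 /c eqxx mul0r -[0 in RHS]subr0 eB subrr.
by rewrite mulr1 /c oner_eq0 mul1r.
Qed.
End GaloisAction.

Lemma gal_perm (sigma : gal_of {:L}) :
  {p : {perm Rn n} | forall v, h (p v) = sigma (h v)}.
Proof.
pose f v := odflt 0 [pick v' | h v' == sigma (h v)].
(* The default 0 in [f] is never reached, by [gal_root]. *)
have fE v : h (f v) = sigma (h v).
  rewrite /f; case: pickP => [v' /eqP //|none].
  by have [v' e'] := gal_root sigma v; have := none v'; rewrite e' eqxx.
have f_inj : injective f.
  by move=> u v euv; apply/h_inj/(fmorph_inj sigma); rewrite /= -!fE euv.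
by exists (perm f_inj) => v; rewrite permE.
Qed.

Lemma gal_affine (sigma : gal_of {:L}) (p : {perm Rn n}) :
  (forall v, h (p v) = sigma (h v)) -> p \in AffRn n.
Proof.
move=> pE; have [u eu] := gal_lam sigma; have [b eb] := gal_lam sigma^-1%g.
have [v0 ev0] : exists v, sigma x0 = h v.
  by apply: root_h; rewrite -gal_iter_g gx0 rmorph0.
rewrite inE; apply/existsP; exists u; apply/existsP; exists v0; apply/andP; split.
  (* The inverse of u comes from the inverse automorphism: e(u b) = sigma(e(b)) =
     sigma(sigma^-1(lam)) = lam = e(1). *)
  apply/existsP; exists b; apply/eqP/(can_inj rVpolyK).
  apply/eqP; rewrite -subr_eq0; apply/eqP/e_eq0.
    by rewrite -linearB; apply: size_poly.
  rewrite eB !e_poly_rV -(gal_linear _ eu) -eb.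
  by rewrite -galM ?memvf // mulVg gal_id -polyC1 eC /c oner_eq0 mul1r subrr.
apply/forallP=> v; apply/eqP/h_inj; rewrite pE /h rmorphD /= ev0 (gal_linear _ eu).
by rewrite linearD /= eD e_poly_rV /h -addrA [X in _ = _ + X]addrC.
Qed.

Lemma gal_isog_AffRn : (2 ^ n * 2 ^ m <= \dim {:L})%N ->
  ('Gal({:L} / 1%AS) \isog AffRn n)%g.
Proof.
move=> le_dim; have [rs [uniq_rs size_rs rsE defL]] := affine_iter_roots.
pose pi (sigma : gal_of {:L}) := sval (gal_perm sigma).
have piE sigma v : h (pi sigma v) = sigma (h v) := svalP (gal_perm sigma) v.
have piM : {in 'Gal({:L} / 1%AS)%g &, {morph pi : x y / (x * y)%g}}.
  by move=> x y _ _; apply/permP=> v; apply: h_inj; rewrite permM !piE galM ?memvf.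
pose phi := Morphism piM.
have injphi : ('injm phi)%g.
  apply/injmP=> x y _ _ /= exy; apply/eqP; rewrite eq_mulgV1; apply/gal_eqP=> a _.
  (* Faithfulness: x y^-1 fixes every root, and the roots generate L. *)
  have fix_roots : (<<1 & rs>> <= fixedField [set (x * y^-1)%g])%VS.
    apply/Fadjoin_seqP; split=> [|r]; first exact: sub1v.
    rewrite rsE => /eqP/root_h[v ->]; apply/fixedFieldP=> [|z /set1P->].
      exact: memvf.
    by rewrite galM ?memvf // -piE exy piE -galM ?memvf // mulgV gal_id.
  have /(subvP fix_roots) : a \in <<1 & rs>>%VS by rewrite defL memvf.
  by move/fixedFieldP => -> //; rewrite ?memvf ?gal_id ?set11.
have galL : galois 1%AS {:L}.
  apply/splitting_galoisField; exists P; split=> //; exact: alg_polyOver.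
have img_sub : (phi @* 'Gal({:L} / 1%AS) \subset AffRn n)%g.
  by apply/subsetP=> _ /morphimP[x _ _ ->]; apply: gal_affine (piE x).
(* The Galois group has order dim L, at least the bound on the order of [AffRn], so the inclusion is
   an equality; this also shows that the set [AffRn] is a group. *)
have img : (phi @* 'Gal({:L} / 1%AS))%g = AffRn n.
  apply/eqP; rewrite eqEcard img_sub card_injm // -galois_dim // dimv1 divn1.
  exact: leq_trans (card_AffRn m) le_dim.
by rewrite -img; apply: sub_isog.
Qed.
End Parametrization.
End AffineGalois.

Theorem theorem5p3 (k : fieldType) (hchar : 2%N \in [pchar k]) (n : nat) (hn : (1 <= n)%N)
  (L : splittingFieldType (kst k))
  (hL : splittingFieldFor 1%VS (map_poly (GRing.in_alg L) (Giter k n)) fullv) :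
  ('Gal({:L} / 1%AS) \isog AffRn n)%g.
Proof.
case: n hn hL => // m _ hL; have char2 := pchar_kst hchar.
have s_neq0 : var_s k != 0 by rewrite tofrac_eq0 polyC_eq0 polyX_eq0.
have split_L : splittingFieldFor 1%VS
  (map_poly (GRing.in_alg L) (iter_poly (var_s k) (var_t k) m.+1)) fullv := hL.
have [[|x0 rs] [_ size_rs rsE _]] := affine_iter_roots char2 s_neq0 split_L.
  by have := expn_gt0 2 m.+1; rewrite -size_rs.
have := rsE x0; rewrite mem_head => /esym/eqP gx0.
have [lam lam_n lam_m] := kernel_generator char2 s_neq0 split_L gx0.
apply: (gal_isog_AffRn char2 s_neq0 split_L gx0 lam_n lam_m).
have char2L : 2 \in [pchar L] by rewrite pchar_lalg.
pose phi (x : L) := x ^+ 2 + (var_s k)%:A * x.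
(* The chain below s has m steps and the chain below t has m + 1, which gives degree at least
   2^(2m+1). *)
apply: (@dim_two_towers _ _ m (fun i => iter (m - i) phi lam)) char2L _
  (tower_w0 char2 gx0) _ (tower_w char2 _ _ x0); first by rewrite subn0.
exact: tower_lam.
Qed.
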